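(* Let $F$ be a $\theta\mathrm{DMBPP}(\lambda,\Psi_\eta,\mathcal{V},\Psi_\theta)$, defined such that $\mathcal{V}$ is a set of equicontinuous functions and such that for every $j\ge1$ the stochastic process $\eta_j$ is a.s. continuous. Then for every sequence $\{x_l\}_{l\ge0}\subseteq\mathcal{X}$ with $\lim_{l\to\infty}x_l=x_0$, $$\lim_{l\to\infty}\sup_{B\in\mathcal{B}(\Delta_m)}|F_{x_l}(B)-F_{x_0}(B)|=0\quad\text{a.s.},$$ i.e., $F_{x_l}$ converges a.s. in total variation norm to $F_{x_0}$.
   Context: Let $m,p\ge 1$. $\Delta_m=\{y\in[0,1]^m:\sum_{i=1}^m y_i\le 1\}$, $\Delta_m^0=\{y\in\Delta_m: y_i>0\ \forall i\}$, $\mathcal{B}(\Delta_m)$ its Borel sets. $\mathrm{dir}(y\mid\alpha)$, $\alpha=(\alpha_1,\dots,\alpha_{m+1})$, is the Dirichlet density $\frac{\Gamma(\sum_i\alpha_i)}{\prod_i\Gamma(\alpha_i)}\prod_{i=1}^m y_i^{\alpha_i-1}(1-\sum_i y_i)^{\alpha_{m+1}-1}$. For $k\in\mathbb{N}$, $\alpha(k,\mathbf{j})=(j_1,\dots,j_m,k+m-\|\mathbf{j}\|_1)$, $\lceil k\theta\rceil=(\lceil k\theta_1\rceil,\dots,\lceil k\theta_m\rceil)$. $\mathcal{X}\subseteq\mathbb{R}^p$. $\mathcal{V}=\{v_x:x\in\mathcal{X}\}$: known continuous functions (described as bijective) $v_x:\mathbb{R}\to[0,1]$ with $x\mapsto v_x(a)$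 continuous for every $a$; ''$\mathcal{V}$ is a set of equicontinuous functions'' means $\{x\mapsto v_x(a):a\in\mathbb{R}\}$ is equicontinuous. $\theta\mathrm{DMBPP}(\lambda,\Psi_\eta,\mathcal{V},\Psi_\theta)$: $\eta_j$, $j\ge1$, i.i.d. real-valued stochastic processes on $\mathcal{X}$ (law indexed by finite-dimensional $\Psi_\eta$); $\theta_j$, $j\ge1$, i.i.d. $\Delta_m^0$-valued random vectors (law indexed by $\Psi_\theta$); $k\in\mathbb{N}$ random (law indexed by $\lambda$); $F_x$ is the probability measure on $\Delta_m$ with Lebesgue density $f_x(\cdot)=\sum_{j\ge1}w_j(x)\mathrm{dir}(\cdot\mid\alpha(k,\lceil k\theta_j\rceil))$, $w_j(x)=V_j(x)\prod_{l<j}(1-V_l(x))$, $V_j(x)=v_x(\eta_j(x))$. The weights sum to one a.s. *)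

(* Defs.v *)
From HB Require Import structures.
From mathcomp Require Import all_boot all_order all_algebra.
From mathcomp Require Import all_classical all_reals all_analysis.

Set Implicit Arguments.
Unset Strict Implicit.
Unset Printing Implicit Defensive.

Import Order.TTheory GRing.Theory Num.Theory.
Import numFieldNormedType.Exports.

Local Open Scope classical_set_scope.
Local Open Scope ring_scope.

Section Defs.
Variable R : realType.

(** * Lebesgue measure on R^m, R^m represented by [m.-tuple R]
    (whose canonical sigma-algebra in MathComp-Analysis is the product
    of the Borel sigma-algebras, i.e. the Borel sets of R^m). *)
Fixpoint lebesgue_tuple (n : nat) : set (n.-tuple R) -> \bar R :=
  match n return set (n.-tuple R) -> \bar R with
  | 0 => fun A => ((\1_A : _ -> R) [tuple])%:E
  | n'.+1 => fun A =>
      (\int[@lebesgue_measure R]_x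
         lebesgue_tuple [set t : n'.-tuple R | A (cons_tuple x t)])%E
  end.

Definition simplex (m : nat) : set (m.-tuple R) :=
  [set y | (forall i, 0 <= tnth y i <= 1) /\ \sum_(i < m) tnth y i <= 1].

Definition simplex0 (m : nat) : set (m.-tuple R) :=
  [set y | simplex y /\ forall i, 0 < tnth y i].

(** * Dirichlet density dir(y | alpha) with alpha = (a_1,..,a_m, a_{m+1})
    positive integers; Gamma(n) = (n-1)! for positive integers n. *)
Definition dir (m : nat) (a : 'I_m -> nat) (alast : nat) (y : m.-tuple R) : R :=
  (((\sum_(i < m) a i) + alast).-1`!%:R
     / ((\prod_(i < m) (a i).-1`!)%:R * (alast.-1`!)%:R))
  * (\prod_(i < m) tnth y i ^+ (a i).-1)
  * (1 - \sum_(i < m) tnth y i) ^+ alast.-1.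

(** ceiling of k * theta_i, a positive integer when k >= 1, theta_i > 0 *)
Definition ceil_k (m k : nat) (theta : m.-tuple R) (i : 'I_m) : nat :=
  `|Num.ceil (k%:R * tnth theta i)|%N.

Definition dir_k (m k : nat) (theta : m.-tuple R) (y : m.-tuple R) : R :=
  dir (ceil_k k theta) (k + m - \sum_(i < m) ceil_k k theta i)%N y.

Definition stickV (p : nat) (v : 'rV[R]_p -> R -> R) (eta : 'rV[R]_p -> R)
  (x : 'rV[R]_p) : R := v x (eta x).

Definition weight (p : nat) (v : 'rV[R]_p -> R -> R)
  (eta : nat -> 'rV[R]_p -> R) (x : 'rV[R]_p) (j : nat) : R :=
  stickV v (eta j) x * \prod_(l < j) (1 - stickV v (eta l) x).

(** * Density f_x and measure F_x, for one realization *)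
Definition dmbpp_density (m p : nat) (v : 'rV[R]_p -> R -> R)
  (eta : nat -> 'rV[R]_p -> R) (theta : nat -> m.-tuple R) (k : nat)
  (x : 'rV[R]_p) (y : m.-tuple R) : \bar R :=
  (\sum_(j <oo) (weight v eta x j * dir_k k (theta j) y)%:E)%E.

Definition dmbpp_measure (m p : nat) (v : 'rV[R]_p -> R -> R)
  (eta : nat -> 'rV[R]_p -> R) (theta : nat -> m.-tuple R) (k : nat)
  (x : 'rV[R]_p) (B : set (m.-tuple R)) : \bar R :=
  (\int[@lebesgue_tuple m]_(y in B) dmbpp_density v eta theta k x y)%E.

Definition tv_dist (m : nat) (F G : set (m.-tuple R) -> \bar R) : \bar R :=
  ereal_sup [set `|(F B - G B)%E|%E | B in
               [set B : set (m.-tuple R) | measurable B /\ B `<=` @simplex m]].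

Definition mutually_independent d (Omega : measurableType d)
  (P : probability Omega R) (G : nat -> set (set Omega)) : Prop :=
  forall (J : seq nat), uniq J -> forall A : nat -> set Omega,
    (forall i, i \in J -> G i (A i)) ->
    P (\bigcap_(i in [set i | i \in J]) A i) =
      (\prod_(i <- J) fine (P (A i)))%:E.

Definition process_sigma d (Omega : measurableType d) (p : nat)
  (X : set 'rV[R]_p) (eta : Omega -> 'rV[R]_p -> R) : set (set Omega) :=
  <<s [set A | exists x B, X x /\ measurable B /\
               A = (fun w => eta w x) @^-1` B] >>.

Definition iid_processes d (Omega : measurableType d) (P : probability Omega R)
  (p : nat) (X : set 'rV[R]_p) (eta : nat -> Omega -> 'rV[R]_p -> R) : Prop :=
  mutually_independent P (fun j => process_sigma X (eta j)) /\
  forall j (n : nat) (xs : n.-tuple 'rV[R]_p) (B : set (n.-tuple R)),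
    (forall i, X (tnth xs i)) -> measurable B ->
    P [set w | B (map_tuple (eta j w) xs)] =
    P [set w | B (map_tuple (eta 0%N w) xs)].

Definition iid_vectors d (Omega : measurableType d) (P : probability Omega R)
  (m : nat) (theta : nat -> Omega -> m.-tuple R) : Prop :=
  (forall j, measurable_fun setT (theta j)) /\
  mutually_independent P
    (fun j => [set theta j @^-1` B | B in [set B | measurable B]]) /\
  forall j (B : set (m.-tuple R)), measurable B ->
    P (theta j @^-1` B) = P (theta 0%N @^-1` B).

End Defs.

(* Main.v *)
(* For a fixed sample point, F_x has the density f_x = sum_j w_j(x) dir_j,
   and on the simplex every Dirichlet kernel dir_j is bounded by (k+m-1)!,
   uniformly in j.  Continuity of eta_j and equicontinuity of V make every
   stick-breaking weight w_j(x) continuous in x; as the weight vectors are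
   probability vectors, Scheffe's lemma turns pointwise convergence
   w(x_l) -> w(x_0) into l^1 convergence.  Hence f_{x_l} -> f_{x_0}
   uniformly on the simplex, and the total variation distance is at most the
   sup-distance times the (finite) Lebesgue measure of the simplex. *)

Require Import Defs.
From HB Require Import structures.
From mathcomp Require Import all_boot all_order all_algebra.
From mathcomp Require Import all_classical all_reals all_analysis.
From mathcomp Require Import lra.

Set Implicit Arguments.
Unset Strict Implicit.
Unset Printing Implicit Defensive.

Import Order.TTheory GRing.Theory Num.Theory.
Import numFieldNormedType.Exports.

Local Open Scope classical_set_scope.
Local Open Scope ring_scope.

(* The library proves this too, but its canonical instance is shadowed by the
   one for products of subprobabilities. *)
Lemma product_measure1_sigma_finite d1 d2 (T1 : measurableType d1)
    (T2 : measurableType d2) (R : realType)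
    (m1 : {sigma_finite_measure set T1 -> \bar R})
    (m2 : {sigma_finite_measure set T2 -> \bar R}) :
  sigma_finite setT (m1 \x m2)%E.
Proof.
have /sigma_finiteP[F [TF ndF Foo]] := sigma_finiteT m1.
have /sigma_finiteP[G [TG ndG Goo]] := sigma_finiteT m2.
exists (fun n => F n `*` G n).
  rewrite -setXTT TF TG predeqE => -[x y]; split.
    move=> [/= [n _ Fnx] [k _ Gky]]; exists (maxn n k) => //; split.
    - by move: x Fnx; exact/subsetPset/ndF/leq_maxl.
    - by move: y Gky; exact/subsetPset/ndG/leq_maxr.
  by move=> [n _ []/= ? ?]; split; exists n.
move=> k; have [? ?] := Foo k; have [? ?] := Goo k.
split; first exact: measurableX.
by rewrite product_measure1E// lte_mul_pinfty// ge0_fin_numE.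
Qed.

Section pushforward_sigma_finite.
Local Open Scope ereal_scope.
Context d1 d2 (T1 : measurableType d1) (T2 : measurableType d2) (R : realType).
Variables (mu : {measure set T1 -> \bar R}) (f : T1 -> T2) (g : T2 -> T1).
Hypotheses (mu_sigma_finite : sigma_finite setT mu)
  (mg : measurable_fun setT g) (fK : cancel f g).

Lemma pushforward_sigma_finite : sigma_finite setT (pushforward mu f).
Proof.
have [F UF mF] := mu_sigma_finite.
exists (fun n => g @^-1` F n).
  by rewrite -preimage_bigcup -UF preimage_setT.
move=> n; have [mFn muFn] := mF n; split.
  by rewrite -[X in measurable X]setTI; exact: mg.
by rewrite /pushforward -comp_preimage (_ : g \o f = id) //; exact: funext.
Qed.

End pushforward_sigma_finite.

Section cons_measure.
Local Open Scope ereal_scope.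
Context {R : realType} {n : nat}.
Variable mu : {sigma_finite_measure set (n.-tuple R) -> \bar R}.

Definition cons_pair (p : R * n.-tuple R) : n.+1.-tuple R := cons_tuple p.1 p.2.

Definition uncons (t : n.+1.-tuple R) : R * n.-tuple R :=
  (thead t, [tuple of behead t]).

Lemma cons_pairK : cancel cons_pair uncons.
Proof. by case=> x t; congr pair; exact: val_inj. Qed.

Lemma measurable_cons_pair : measurable_fun setT cons_pair.
Proof. exact: measurable_cons. Qed.

Lemma measurable_uncons : measurable_fun setT uncons.
Proof.
by apply/measurable_fun_pairP; split; [exact: measurable_tnth | exact: measurable_behead].
Qed.

Definition cons_measure := pushforward (@lebesgue_measure R \x mu) cons_pair.

(* The library's measure instance on [pushforward] takes the measurability of
   the map as an argument, so it has to be supplied by hand. *)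
HB.instance Definition _ := Measure.copy cons_measure
  (measure_function_pushforward__canonical__measure_function_Measure
     (@lebesgue_measure R \x mu) measurable_cons_pair).

HB.instance Definition _ := Measure_isSigmaFinite.Build _ _ _ cons_measure
  (pushforward_sigma_finite
     (product_measure1_sigma_finite (@lebesgue_measure R) mu)
     measurable_uncons cons_pairK).

End cons_measure.

Definition l1_ball (R : realType) n (r : R) : set (n.-tuple R) :=
  [set t | (\sum_(i < n) `|tnth t i| <= r)%R].
Arguments l1_ball {R} n r.

Section tuple_lebesgue.
Local Open Scope ereal_scope.
Variable R : realType.

(* [lebesgue_tuple] is a bare set function; [tuple_lebesgue] is the same
   function (see [tuple_lebesgueE]) with its structure of measure. *)
Fixpoint tuple_lebesgue n : {sigma_finite_measure set (n.-tuple R) -> \bar R} :=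
  match n with
  | 0 => \d_[tuple]
  | n'.+1 => cons_measure (tuple_lebesgue n')
  end.

Lemma tuple_lebesgueE n : tuple_lebesgue n = @lebesgue_tuple R n :> (set _ -> _).
Proof.
apply/funext; elim: n => [|n IH] A //=.
rewrite /cons_measure /pushforward /product_measure1.
apply: eq_integral => x _ /=; rewrite IH; congr lebesgue_tuple.
by apply/seteqP; split => t; rewrite /xsection/= inE.
Qed.

Lemma measurable_l1_ball n (r : R) : measurable (l1_ball n r).
Proof.
have mnorm : measurable_fun setT
    (fun t : n.-tuple R => \sum_(i < n) `|tnth t i|)%R.
  apply: measurable_sum => i; apply: measurableT_comp => //.
  exact: measurable_tnth.
rewrite -[l1_ball n r]setTI.
by apply: (mnorm measurableT [set` `]-oo, r]]%R) => //; rewrite /l1_ball setTI.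
Qed.

Lemma cons_pair_l1_ball n (r : R) :
  cons_pair @^-1` l1_ball n.+1 r `<=` `[(- r)%R, r]%classic `*` l1_ball n r.
Proof.
move=> [x t]; rewrite /l1_ball /cons_pair /= big_ord_recl /=.
rewrite (tnth_nth 0%R) /=.
under eq_bigr do rewrite (tnth_nth 0%R) /= -(tnth_nth 0%R).
have t_ge0 : (0 <= \sum_(i < n) `|tnth t i|)%R by apply: sumr_ge0.
move=> xt_le; split; last by rewrite (le_trans _ xt_le) // lerDr.
by rewrite /= in_itv /= -ler_norml (le_trans _ xt_le) // lerDl.
Qed.

Lemma tuple_lebesgue_l1_ball_lty n (r : R) : tuple_lebesgue n (l1_ball n r) < +oo.
Proof.
elim: n r => [|n IH] r /=; first by rewrite /dirac ltry.
have mball : measurable (l1_ball n r) := measurable_l1_ball _.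
pose box := `[(- r)%R, r]%classic `*` l1_ball n r.
apply: (@le_lt_trans _ _ ((@lebesgue_measure R \x tuple_lebesgue n) box)).
  apply: (@le_measure _ _ _ (@lebesgue_measure R \x tuple_lebesgue n)
    _ _ _ _ (@cons_pair_l1_ball n r)); rewrite inE.
    rewrite -[X in measurable X]setTI.
    by apply: measurable_cons_pair => //; exact: measurable_l1_ball.
  exact: measurableX.
rewrite product_measure1E // lte_mul_pinfty // ge0_fin_numE //.
by rewrite compact_finite_measure //; exact: segment_compact.
Qed.

End tuple_lebesgue.

Section partial_sums.
Variable R : realFieldType.
Implicit Types f : nat -> R.

Lemma partial_sumB f N n : (N <= n)%N ->
  \sum_(j < n) f j - \sum_(j < N) f j = \sum_(N <= j < n) f j.
Proof.
by move=> Nn; rewrite -!(big_mkord xpredT) (big_cat_nat (leq0n N) Nn) addrC addKr.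
Qed.

Lemma partial_sum_le f N n : (forall j, 0 <= f j) -> (N <= n)%N ->
  \sum_(j < N) f j <= \sum_(j < n) f j.
Proof. by move=> f_ge0 Nn; rewrite -subr_ge0 partial_sumB // sumr_ge0. Qed.

Lemma partial_sum_le_lim f (s : R) : (forall j, 0 <= f j) ->
  (fun n => \sum_(j < n) f j) @ \oo --> s -> forall n, \sum_(j < n) f j <= s.
Proof.
move=> f_ge0 fs n; rewrite -(cvg_lim _ fs) //.
by apply: nondecreasing_cvgn_le (cvgP _ fs) n => N n' /partial_sum_le; exact.
Qed.

Lemma scheffe (a : nat -> nat -> R) (b : nat -> R) :
  (forall l j, 0 <= a l j) -> (forall l n, \sum_(j < n) a l j <= 1) ->
  (forall j, 0 <= b j) -> (fun n => \sum_(j < n) b j) @ \oo --> (1 : R) ->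
  (forall j, a ^~ j @ \oo --> b j) ->
  forall e, 0 < e ->
  \forall l \near \oo, forall n, \sum_(j < n) `|a l j - b j| <= e.
Proof.
move=> a_ge0 a_le1 b_ge0 b1 ab e e_gt0.
have e4_gt0 : 0 < e / 4 by rewrite divr_gt0.
have b_le1 := partial_sum_le_lim b_ge0 b1.
have [N _ /(_ N (leqnn N)) bN] := (cvgrPdist_lt _ _).1 b1 _ e4_gt0.
have headN : (fun l => \sum_(j < N) `|a l j - b j|) @ \oo --> 0.
  rewrite [X in _ --> X](_ : 0 = \sum_(j < N) `|b j - b j|); last first.
    by rewrite big1 // => j _; rewrite subrr normr0.
  apply: cvg_big => [|j _]; first exact: add_continuous.
  by apply: cvg_norm; apply: cvgB => //; exact: cvg_cst.
have [L _ headL] := (cvgr0Pnorm_lt _).1 headN _ e4_gt0.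
near=> l => n.
have head_small : \sum_(j < N) `|a l j - b j| < e / 4.
  have /= := headL l; rewrite ger0_norm ?sumr_ge0 //; apply.
  by near: l; exists L.
wlog Nn : n / (N <= n)%N => [wlog_n|].
  have [/wlog_n //|/ltnW nN] := leqP N n.
  rewrite (le_trans _ (wlog_n N (leqnn N))) //.
  by apply: (@partial_sum_le (fun j => `|a l j - b j|)).
have head_diff :
    \sum_(j < N) b j - \sum_(j < N) a l j <= \sum_(j < N) `|a l j - b j|.
  by rewrite -sumrB; apply: ler_sum => j _; rewrite distrC ler_norm.
have tail_le : \sum_(N <= j < n) `|a l j - b j| <=
    \sum_(N <= j < n) a l j + \sum_(N <= j < n) b j.
  rewrite -big_split; apply: ler_sum => j _.
  by rewrite (le_trans (ler_normB _ _)) // !ger0_norm.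
move: tail_le; rewrite -!partial_sumB //.
have := a_le1 l n; have := b_le1 n; move: bN; rewrite ltr_norml; lra.
Unshelve. all: by end_near.
Qed.

End partial_sums.

Section mixture.
Variable R : realType.

(* A junk value unless the partial sums converge, as they do for the bounded
   mixtures below. *)
Definition mixture (a D : nat -> R) : R :=
  limn (fun n => \sum_(j < n) a j * D j).

Section bounded_mixture.
Variables (a D : nat -> R) (C : R).
Hypotheses (a_ge0 : forall j, 0 <= a j) (a_le1 : forall n, \sum_(j < n) a j <= 1).
Hypothesis D_itv : forall j, 0 <= D j <= C.

Let aD_ge0 j : 0 <= a j * D j.
Proof. by rewrite mulr_ge0 // (andP (D_itv j)).1. Qed.

Lemma mixture_partial_sum_itv n : 0 <= \sum_(j < n) a j * D j <= C.
Proof.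
have C_ge0 : 0 <= C by have /andP[/le_trans] := D_itv 0; exact.
rewrite sumr_ge0 //= (@le_trans _ _ (\sum_(j < n) a j * C)) //.
  by apply: ler_sum => j _; rewrite ler_wpM2l // (andP (D_itv j)).2.
by rewrite -mulr_suml ler_piMl.
Qed.

Lemma is_cvg_mixture : cvgn (fun n => \sum_(j < n) a j * D j).
Proof.
apply: nondecreasing_is_cvgn.
  by move=> N n /(@partial_sum_le _ (fun j => a j * D j)); exact.
by exists C => _ [n _ <-]; have /andP[] := mixture_partial_sum_itv n.
Qed.

Lemma mixture_itv : 0 <= mixture a D <= C.
Proof.
have mixture_cvg := is_cvg_mixture.
apply/andP; split; [apply: limr_ge | apply: limr_le] => //;
  by near=> n; have /andP[] := mixture_partial_sum_itv n.
Unshelve. all: by end_near.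
Qed.

Lemma nneseries_mixture : (\sum_(j <oo) (a j * D j)%:E)%E = (mixture a D)%:E.
Proof.
rewrite -EFin_lim; last exact: is_cvg_mixture.
rewrite (_ : (fun n => \sum_(0 <= j < n) (a j * D j)%:E)%E =
  EFin \o (fun n => \sum_(j < n) a j * D j)) //.
by apply/funext => n /=; rewrite sumEFin big_mkord.
Qed.

End bounded_mixture.

Lemma mixture_dist (a b D : nat -> R) (C e : R) :
  (forall j, 0 <= a j) -> (forall n, \sum_(j < n) a j <= 1) ->
  (forall j, 0 <= b j) -> (forall n, \sum_(j < n) b j <= 1) ->
  (forall j, 0 <= D j <= C) ->
  (forall n, \sum_(j < n) `|a j - b j| <= e) ->
  `|mixture a D - mixture b D| <= C * e.
Proof.
move=> a_ge0 a_le1 b_ge0 b_le1 D_itv ab_e.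
have C_ge0 : 0 <= C by have /andP[/le_trans] := D_itv 0; exact.
have dist_cvg : (fun n => `|\sum_(j < n) a j * D j - \sum_(j < n) b j * D j|)
    @ \oo --> `|mixture a D - mixture b D|.
  by apply: cvg_norm; apply: cvgB; exact: is_cvg_mixture.
rewrite -(cvg_lim _ dist_cvg) //; apply: limr_le; first exact: cvgP dist_cvg.
near=> n; rewrite /= -sumrB (le_trans (ler_norm_sum _ _ _)) //.
apply: le_trans (_ : \sum_(j < n) `|a j - b j| * C <= _).
  apply: ler_sum => j _; rewrite -mulrBl normrM.
  by have /andP[D_ge0 D_le] := D_itv j; rewrite (ger0_norm D_ge0) ler_wpM2l.
by rewrite -mulr_suml mulrC ler_wpM2l.
Unshelve. all: by end_near.
Qed.

Lemma measurable_mixture d (T : measurableType d) (a : nat -> R)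
    (D : nat -> T -> R) (S : set T) :
  (forall j, measurable_fun setT (D j)) ->
  (forall y, S y -> cvgn (fun n => \sum_(j < n) a j * D j y)) ->
  measurable_fun S (fun y => mixture a (D ^~ y)).
Proof.
move=> mD D_cvg.
apply: (measurable_realfun.measurable_fun_cvg
  (h := fun n y => \sum_(j < n) a j * D j y)) => [n|y /D_cvg//].
apply: measurable_funS (subsetT _) _ => //.
by apply: measurable_sum => j; apply: measurable_realfun.measurable_funM => //;
  exact: measurable_cst.
Qed.

End mixture.

Section dirichlet.
Variables (R : realType) (m : nat).

Lemma sum_ceil_k_le (K : nat) (th : m.-tuple R) :
  (forall i, 0 < tnth th i) -> \sum_(i < m) tnth th i <= 1 ->
  (\sum_(i < m) ceil_k K th i <= K + m)%N.
Proof.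
move=> th_gt0 th_le1; rewrite -(ler_nat R) natr_sum natrD.
have ceil_le i : (ceil_k K th i)%:R <= K%:R * tnth th i + 1 :> R.
  have Kth_ge0 : 0 <= K%:R * tnth th i by rewrite mulr_ge0 // ltW.
  rewrite /ceil_k natr_absz ger0_norm ?ceil_ge0; last exact: lt_le_trans Kth_ge0.
  apply: ltW; rewrite -ltrBlDr.
  by have := ceilB1_lt (K%:R * tnth th i); rewrite intrB.
apply: le_trans (ler_sum _ (fun i _ => ceil_le i)) _.
by rewrite big_split /= -mulr_sumr sumr_const card_ord lerD2r ler_piMr.
Qed.

Lemma dir_k_itv (K : nat) (th y : m.-tuple R) :
  (forall i, 0 < tnth th i) -> \sum_(i < m) tnth th i <= 1 ->
  simplex y -> 0 <= dir_k K th y <= (K + m).-1`!%:R.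
Proof.
move=> th_gt0 th_le1 [y_itv y_le1].
have y_ge0 i : 0 <= tnth y i by have /andP[] := y_itv i.
rewrite /dir_k /dir subnKC; last exact: sum_ceil_k_le.
set c := (_ / _); set P := \prod_(i < m) _; set Q := _ ^+ _.
have P_itv : 0 <= P <= 1.
  apply/andP; split; [apply: prodr_ge0 | apply: prodr_ile1] => i _.
    exact: exprn_ge0.
  by have /andP[? ?] := y_itv i; rewrite exprn_ge0 ?exprn_ile1.
have Q_itv : 0 <= Q <= 1.
  have y_sum_ge0 : 0 <= \sum_(i < m) tnth y i by exact: sumr_ge0.
  by rewrite exprn_ge0 ?exprn_ile1 ?subr_ge0 // lerBlDr lerDl.
have den_ge1 : 1 <= ((\prod_(i < m) (ceil_k K th i).-1`!)%:R *
    ((K + m - \sum_(i < m) ceil_k K th i).-1`!)%:R :> R).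
  rewrite -natrM (ler_nat R 1) muln_gt0 fact_gt0 prodn_gt0 // => i.
  exact: fact_gt0.
have c_itv : 0 <= c <= (K + m).-1`!%:R.
  rewrite divr_ge0 //= ler_pdivrMr ?ler_peMr //; exact: lt_le_trans ltr01 den_ge1.
case/andP: P_itv => P_ge0 P_le1; case/andP: Q_itv => Q_ge0 Q_le1.
case/andP: c_itv => c_ge0 c_le.
rewrite !mulr_ge0 //= -mulrA (le_trans _ c_le) // ler_piMr // ?mulr_ge0 //.
exact: mulr_ile1.
Qed.

Lemma measurable_dir_k (K : nat) (th : m.-tuple R) :
  measurable_fun setT (dir_k K th).
Proof.
rewrite /dir_k /dir; apply: measurable_realfun.measurable_funM.
  apply: measurable_realfun.measurable_funM; first exact: measurable_cst.
  apply: measurable_prod => i _; apply: measurable_realfun.measurable_funX.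
  exact: measurable_tnth.
apply/measurable_realfun.measurable_funX/measurable_realfun.measurable_funB.
  exact: measurable_cst.
by apply: measurable_sum => i; exact: measurable_tnth.
Qed.

End dirichlet.

Section weights.
Variables (R : realType) (p : nat).
Variables (X : set 'rV[R]_p) (v : 'rV[R]_p -> R -> R).

Lemma weight_ge0 (eta : nat -> 'rV[R]_p -> R) x j :
  (forall a, 0 <= v x a <= 1) -> 0 <= weight v eta x j.
Proof.
move=> v_itv; rewrite /weight /stickV mulr_ge0 ?(andP (v_itv _)).1 //.
by apply: prodr_ge0 => i _; rewrite subr_ge0 (andP (v_itv _)).2.
Qed.

Hypotheses (v_cont : forall x, X x -> continuous (v x))
  (v_equicont : equicontinuous [set: R] (fun a => (fun x : subspace X => v x a))).
Variables (xs : nat -> 'rV[R]_p) (x0 : 'rV[R]_p).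
Hypotheses (xs_in : forall l, X (xs l)) (x0_in : X x0) (xs_cvg : xs @ \oo --> x0).

(* Equicontinuity makes x |-> v x (e x') continuous uniformly in x', which
   handles the simultaneous move of both arguments. *)
Lemma cvg_stickV (e : 'rV[R]_p -> R) : {within X, continuous e} ->
  (fun l => stickV v e (xs l)) @ \oo --> stickV v e x0.
Proof.
move=> e_cont.
have xs_cvgX : (xs : nat -> subspace X) @ \oo --> (x0 : subspace X).
  move=> A A_near; have : within X (nbhs x0) A by rewrite nbhs_subspace_in.
  by move=> /xs_cvg[N _ AN]; exists N => // n /AN; apply.
have e_cvg : (fun l => e (xs l)) @ \oo --> e x0.
  exact: (cvg_comp _ (from_subspace X e) xs_cvgX (e_cont x0)).
have v_cvg : (fun l => v x0 (e (xs l))) @ \oo --> v x0 (e x0).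
  apply: (cvg_comp _ _ e_cvg); exact: v_cont.
apply/cvgrPdist_lt => eps eps_gt0.
have eps2_gt0 : 0 < eps / 2 by rewrite divr_gt0.
have [N _ v_near] :=
  xs_cvgX _ (v_equicont x0 (entourage_ball _ (PosNum eps2_gt0))).
near=> l.
have close_x : `|v x0 (e (xs l)) - v (xs l) (e (xs l))| < eps / 2.
  by apply: (v_near l _ (e (xs l)) I); near: l; exists N.
have close_e : `|v x0 (e x0) - v x0 (e (xs l))| < eps / 2.
  by near: l; exact: (cvgrPdist_lt _ _).1 v_cvg _ eps2_gt0.
rewrite /stickV (le_lt_trans (ler_distD (v x0 (e (xs l))) _ _)) //.
by rewrite (splitr eps) ltrD.
Unshelve. all: by end_near.
Qed.

Lemma cvg_weight (eta : nat -> 'rV[R]_p -> R) j :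
  (forall i, {within X, continuous (eta i)}) ->
  (fun l => weight v eta (xs l) j) @ \oo --> weight v eta x0 j.
Proof.
move=> eta_cont; apply: cvgM; first exact: cvg_stickV.
apply: cvg_big => [|i _]; first exact: mul_continuous.
by apply: cvgB; [exact: cvg_cst | exact: cvg_stickV].
Qed.

End weights.

Section integral_bounds.
Local Open Scope ereal_scope.
Context d (T : measurableType d) (R : realType).
Variable mu : {measure set T -> \bar R}.

Lemma abse_integralB_le (B : set T) (f g : T -> R) (c : R) : measurable B ->
  mu.-integrable B (EFin \o f) -> mu.-integrable B (EFin \o g) -> (0 <= c)%R ->
  (forall y, B y -> `|f y - g y| <= c)%R ->
  `|\int[mu]_(y in B) (f y)%:E - \int[mu]_(y in B) (g y)%:E| <= c%:E * mu B.
Proof.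
move=> mB intf intg c_ge0 fg_le.
have mf := measurable_int _ intf; have mg := measurable_int _ intg.
rewrite -integralB_EFin //; apply: le_trans (le_abse_integral _ _ _) _ => //.
  exact: emeasurable_funB.
apply: integral_le_bound => //; first exact: emeasurable_funB.
by apply: aeW => y By; rewrite -EFinB abse_EFin lee_fin fg_le.
Qed.

End integral_bounds.

Section ereal_cvg.
Local Open Scope ereal_scope.
Variable R : realType.

Lemma cvge0_le (u : nat -> \bar R) (K : R) : (forall l, 0 <= u l) ->
  (forall e, (0 < e)%R -> \forall l \near \oo, u l <= (K * e)%:E) ->
  u @ \oo --> 0.
Proof.
move=> u_ge0 u_small; apply/fine_cvgP; split.
  apply: filterS (u_small 1%R ltr01) => l u_le.
  by rewrite fin_numElt (lt_le_trans _ (u_ge0 l)) ?(le_lt_trans u_le) ?ltry ?ltNyr.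
apply/cvgr0Pnorm_le => eps eps_gt0.
have K1_gt0 : (0 < `|K| + 1)%R by rewrite ltr_pwDr.
have e_gt0 : (0 < eps / (`|K| + 1))%R by rewrite divr_gt0.
near=> l.
have u_le : u l <= (K * (eps / (`|K| + 1)))%:E by near: l; exact: u_small.
have /andP[fine_ge0 fine_le] : (0 <= fine (u l) <= K * (eps / (`|K| + 1)))%R.
  by move: (u_ge0 l) u_le; case: (u l) => //= r; rewrite !lee_fin => -> ->.
rewrite /= ger0_norm // (le_trans fine_le) //.
rewrite mulrA ler_pdivrMr // mulrC ler_pM2l // (le_trans (ler_norm K)) // lerDl.
Unshelve. all: by end_near.
Qed.

End ereal_cvg.

Section tv_dist_mixture.
Variables (R : realType) (m : nat).
Local Notation simplex := (@simplex R m).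
Variables (a : nat -> nat -> R) (D : nat -> m.-tuple R -> R) (C : R).
Variable F : nat -> set (m.-tuple R) -> \bar R.
Hypotheses (a_ge0 : forall l j, 0 <= a l j)
  (a_le1 : forall l n, \sum_(j < n) a l j <= 1).
Hypotheses (a0_sum1 : (fun n => \sum_(j < n) a 0%N j) @ \oo --> (1 : R))
  (a_cvg : forall j, a ^~ j @ \oo --> a 0%N j).
Hypotheses (C_ge0 : 0 <= C) (D_meas : forall j, measurable_fun setT (D j))
  (D_itv : forall j y, simplex y -> 0 <= D j y <= C).
Hypothesis F_mixture : forall l B, measurable B -> B `<=` simplex ->
  F l B = (\int[@lebesgue_tuple R m]_(y in B) (mixture (a l) (D ^~ y))%:E)%E.

Let mu := tuple_lebesgue R m.
Let g l y := mixture (a l) (D ^~ y).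
Let M := mu (l1_ball m 1).

Let simplex_l1_ball : simplex `<=` l1_ball m 1.
Proof.
move=> y [y_itv y_le1]; apply: le_trans y_le1; apply: ler_sum => i _.
by rewrite ger0_norm // (andP (y_itv i)).1.
Qed.

Let M_fin : M \is a fin_num.
Proof.
by rewrite ge0_fin_numE ?measure_ge0 //; exact: tuple_lebesgue_l1_ball_lty.
Qed.

Let mu_le_M B : measurable B -> B `<=` simplex -> (mu B <= M)%E.
Proof.
move=> mB /subset_trans/(_ simplex_l1_ball) sB.
by apply: le_measure => //; rewrite inE //; exact: measurable_l1_ball.
Qed.

Let integrable_g l B : measurable B -> B `<=` simplex ->
  mu.-integrable B (EFin \o g l).
Proof.
move=> mB sB; apply: measurable_bounded_integrable => //.
- by apply: le_lt_trans (mu_le_M mB sB) _; rewrite ltey_eq M_fin.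
- apply: measurable_mixture => // y /sB y_simplex.
  exact: is_cvg_mixture (a_ge0 l) (a_le1 l) (fun j => D_itv j y_simplex).
exists C; split; first exact: num_real.
move=> c C_lt_c y /sB y_simplex; apply: le_trans (ltW C_lt_c).
have /andP[g_ge0 g_le] :=
  mixture_itv (a_ge0 l) (a_le1 l) (fun j => D_itv j y_simplex).
by rewrite ger0_norm.
Qed.

Let tv_dist_le l c : 0 <= c -> (forall y, simplex y -> `|g l y - g 0%N y| <= c) ->
  (tv_dist (F l) (F 0%N) <= c%:E * M)%E.
Proof.
move=> c_ge0 g_close; apply: ge_ereal_sup => _ [B [mB sB] <-].
rewrite !F_mixture // -tuple_lebesgueE.
apply: le_trans (abse_integralB_le mB (integrable_g l mB sB)
  (integrable_g 0 mB sB) c_ge0 (fun y By => g_close y (sB y By))) _.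
by rewrite lee_wpmul2l ?lee_fin ?mu_le_M.
Qed.

Lemma tv_dist_mixture_cvg0 : (fun l => tv_dist (F l) (F 0%N)) @ \oo --> 0%E.
Proof.
apply: (@cvge0_le _ _ (C * fine M)) => [l|e e_gt0].
  have simplex0 : set0 `<=` simplex by exact: sub0set.
  apply: ereal_sup_ubound; exists set0 => //.
  by rewrite !F_mixture // -tuple_lebesgueE !integral_set0 sube0 abse0.
have := scheffe a_ge0 a_le1 (a_ge0 0) a0_sum1 a_cvg e_gt0.
apply: filterS => l l1_small; apply: le_trans (tv_dist_le (c := C * e) _ _) _.
- by rewrite mulr_ge0 // ltW.
- move=> y y_simplex; apply: mixture_dist (a_le1 l) _ (a_le1 0) _ l1_small => //.
  by move=> j; exact: D_itv.
by rewrite -(fineK M_fin) -EFinM lee_fin mulrAC.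
Qed.

End tv_dist_mixture.

Theorem theorem6
  (R : realType) (m p : nat) (m_ge1 : (0 < m)%N) (p_ge1 : (0 < p)%N)
  (d : measure_display) (Omega : measurableType d) (P : probability Omega R)
  (X : set 'rV[R]_p)
  (v : 'rV[R]_p -> R -> R)
  (eta : nat -> Omega -> 'rV[R]_p -> R)
  (theta : nat -> Omega -> m.-tuple R)
  (k : Omega -> nat)
  (* the known functions v_x : R -> [0,1] *)
  (v_range : forall x a, X x -> 0 <= v x a <= 1)
  (v_cont : forall x, X x -> continuous (v x))
  (v_cont_x : forall a, {within X, continuous (fun x => v x a)})
  (* eta_j : i.i.d. real-valued stochastic processes on X *)
  (eta_meas : forall j x, X x -> measurable_fun setT (fun w => eta j w x))
  (eta_iid : iid_processes P X eta)
  (* theta_j : i.i.d. Delta_m^0-valued random vectors *)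
  (theta_iid : iid_vectors P theta)
  (theta_val : forall j w, simplex0 (theta j w))
  (* k : random positive integer *)
  (k_meas : measurable_fun setT k)
  (k_pos : forall w, (0 < k w)%N)
  (* the weights sum to one a.s. *)
  (w_sum1 : forall x, X x -> {ae P, forall w,
     (fun n : nat => \sum_(j < n) weight v (eta ^~ w) x j) @ \oo --> (1 : R)})
  (* V is a set of equicontinuous functions *)
  (V_equicont : equicontinuous [set: R]
     (fun a => (fun x : subspace X => v x a)))
  (* every eta_j is a.s. continuous *)
  (eta_cont : forall j, {ae P, forall w, {within X, continuous (eta j w)}})
  (xs : nat -> 'rV[R]_p)
  (xs_in : forall l, X (xs l))
  (xs_cvg : xs @ \oo --> xs 0%N) :
  {ae P, forall w,
     (fun l => tv_dist
        (dmbpp_measure v (eta ^~ w) (theta ^~ w) (k w) (xs l))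
        (dmbpp_measure v (eta ^~ w) (theta ^~ w) (k w) (xs 0%N)))
     @ \oo --> 0%E}.
Proof.
have sums1 := ae_foralln (fun l => w_sum1 (xs l) (xs_in l)).
apply: filterS2 sums1 (ae_foralln eta_cont) => w sum1 eta_w_cont.
have w_ge0 l j : 0 <= weight v (eta ^~ w) (xs l) j.
  by apply: weight_ge0 => a; exact: v_range.
have dir_itv j y :
    simplex y -> 0 <= dir_k (k w) (theta j w) y <= (k w + m).-1`!%:R.
  by have [[_ th_le1] th_gt0] := theta_val j w; exact: dir_k_itv.
apply: (@tv_dist_mixture_cvg0 _ _ (fun l => weight v (eta ^~ w) (xs l))
  (fun j => dir_k (k w) (theta j w)) (k w + m).-1`!%:R) => //.
- by move=> l; apply: partial_sum_le_lim; [exact: w_ge0 | exact: sum1].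
- by move=> j; exact: (cvg_weight v_cont V_equicont xs_in (xs_in 0%N) xs_cvg).
- by move=> j; exact: measurable_dir_k.
move=> l B mB sB; rewrite /dmbpp_measure -tuple_lebesgueE.
apply: eq_integral => y /[!inE] By.
apply: nneseries_mixture => [j | n | j]; first exact: w_ge0.
  by apply: partial_sum_le_lim; [exact: w_ge0 | exact: sum1].
exact: dir_itv (sB y By).
Qed.
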